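(* (i) SWD does not imply DSWL: there exists a network sequence $(\Omega_N)_{N}$ that is SWD but is not DSWL. (ii) DSWMd does not imply SWMd: there exists a network sequence $(\Omega_N)_{N}$ that is DSWMd but is not SWMd.
   Context: A network is a finite, simple, undirected, connected graph. A network sequence is a sequence $(\Omega_N)_{N}$ in which $\Omega_N$ is a network with exactly $N$ nodes (the first few values of $N$ are irrelevant for the limits below). Write $\delta_1(\Omega_N)\ge \delta_2(\Omega_N)\ge\dots\ge\delta_N(\Omega_N)$ for the node degrees of $\Omega_N$ in decreasing order, and $d(A,B)$ for the shortest-path distance between nodes $A,B$ of $\Omega_N$. Degree small worlds: $(\Omega_N)$ is DSWL if $\lim_{N\to\infty}\delta_1(\Omega_N)/\ln(N)=+\infty$; it is DSWMd if $\lim_{N\to\infty} Md(\Omega_N)/\ln(N)=+\infty$, where $Md(\Omega_N)$ is the median of the multiset of the $N$ node degrees. Distance small worlds: $(\Omega_N)$ is SWD if there is a finite constant $C\ge 0$ with $\lim_{N\to\infty} d_N/\ln(N)=C$, where $d_N=\max\{d(A,B): A,B\in\Omega_N\}$ is the diameter; it is SWMd if there is a finite constant $C\ge 0$ with $\lim_{N\to\infty} Md_N/\ln(N)=C$, where $Md_N$ is the median of the multiset of distances $d(A,B)$ over pairs of distinct nodes $A\ne B$ of $\Omega_N$. The median of a multiset of even size is the average of the two middle values. *)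

(* Defs.v *)
From HB Require Import structures.
From mathcomp Require Import all_boot all_order all_algebra.
From mathcomp Require Import all_classical all_reals all_analysis.

Set Implicit Arguments.
Unset Strict Implicit.
Unset Printing Implicit Defensive.

Import Order.TTheory GRing.Theory Num.Theory.
Import numFieldNormedType.Exports.

Local Open Scope classical_set_scope.
Local Open Scope ring_scope.

Record network := Network {
  node : finType;
  adj : rel node;
  adj_sym : symmetric adj;
  adj_irrefl : irreflexive adj;
  adj_connected : forall A B : node, connect adj A B }.

(* There is no constraint at N = 0, which plays no role in the limits. *)
Definition network_sequence (Omega : nat -> network) : Prop :=
  forall N : nat, (0 < N)%N -> #|node (Omega N)| = N.

Section Network.
Variable G : network.

Definition degree (A : node G) : nat := #|[set B | adj A B]%SET|.

Definition degrees : seq nat := [seq degree A | A <- enum (node G)].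

(* 1-based, as is usual for rank-frequency sequences: delta 1 is the largest
   degree. *)
Definition delta (k : nat) : nat := nth 0%N (sort geq degrees) k.-1.

Definition has_walk (A B : node G) (n : nat) : bool :=
  [exists p : n.-tuple (node G), path (@adj G) A p && (last A p == B)].

Lemma has_walk_ex (A B : node G) : exists n : nat, has_walk A B n.
Proof.
have /connectP[p Ap ->] := adj_connected A B.
by exists (size p); apply/existsP; exists (in_tuple p); rewrite Ap eqxx.
Qed.

Definition dist (A B : node G) : nat := ex_minn (has_walk_ex A B).

Definition diameter : nat := (\max_(A : node G) \max_(B : node G) dist A B)%N.

(* Every unordered pair is listed twice, as (A, B) and as (B, A); doubling all
   multiplicities of a multiset does not change its median. *)
Definition distances : seq nat :=
  [seq dist p.1 p.2 | p <- enum {: node G * node G} & p.1 != p.2].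

End Network.

Section SmallWorlds.
Variable R : realType.

Definition median (s : seq nat) : R :=
  let t := sort leq s in
  let h := (size s)./2 in
  if odd (size s) then (nth 0%N t h)%:R
  else ((nth 0%N t h.-1)%:R + (nth 0%N t h)%:R) / 2%:R.

Variable Omega : nat -> network.

Definition DSWL : Prop :=
  (fun N : nat => (delta (Omega N) 1)%:R / ln (N%:R : R)) @ \oo --> +oo.

Definition DSWMd : Prop :=
  (fun N : nat => median (degrees (Omega N)) / ln (N%:R : R)) @ \oo --> +oo.

Definition SWD : Prop :=
  exists C : R, 0 <= C /\
    (fun N : nat => (diameter (Omega N))%:R / ln (N%:R : R)) @ \oo --> C.

Definition SWMd : Prop :=
  exists C : R, 0 <= C /\
    (fun N : nat => median (distances (Omega N)) / ln (N%:R : R)) @ \oo --> C.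

End SmallWorlds.

(* Main.v *)
Require Import Defs.
From mathcomp Require Import all_boot all_order all_algebra.
From mathcomp Require Import all_classical all_reals all_analysis.
From mathcomp Require Import zify lra.

(** Let [k] be about [log N].  For (i), the complete [k]-ary tree on [N] nodes
    has all degrees at most [k + 1], hence of order [ln N], while its diameter
    is at most twice its depth, of order [ln N / ln k = o(ln N)], so that SWD
    holds with [C = 0].  For (ii), join [i] and [j] in [{0, ..., N - 1}] when
    [0 < |i - j| <= k^2 + 1]: for large [N] all degrees exceed [k^2], of larger
    order than [ln N], and a distance below [k^2] forces [|i - j| <= k^4], which
    holds for fewer than half of the pairs, so the median distance is also of
    order at least [k^2]. *)

Set Implicit Arguments.
Unset Strict Implicit.
Unset Printing Implicit Defensive.

Import Order.TTheory GRing.Theory Num.Theory.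
Import numFieldNormedType.Exports.

Local Open Scope classical_set_scope.
Local Open Scope nat_scope.

(** * Lower bounds for medians *)

Lemma nth_sorted_ge (s : seq nat) (t h : nat) :
  sorted leq s -> h < size s -> count (fun x => x < t) s <= h ->
  t <= nth 0 s h.
Proof.
move=> s_sorted lt_h; apply: contraTT; rewrite -!ltnNge => nth_lt.
(* By sortedness, an entry below [t] at the 0-based index [h] puts [h.+1] entries below [t]. *)
have all_lt : all (fun x => x < t) (take h.+1 s).
  apply/(all_nthP 0) => i; rewrite size_takel // ltnS => le_ih.
  rewrite nth_take //; apply: leq_ltn_trans nth_lt.
  apply: (sorted_leq_nth leq_trans leqnn) => //.
  by rewrite inE (leq_ltn_trans le_ih).
rewrite -[s in count _ s](cat_take_drop h.+1) count_cat.
by move: all_lt; rewrite all_count => /eqP ->; rewrite size_takel // leq_addr.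
Qed.

(** Only the upper middle value is known to reach [t]. For even size the lower one is bounded just
    by 0, which costs the factor 2. *)
Lemma median_ge (R : realType) (s : seq nat) (t : nat) :
  0 < size s -> count (fun x => x < t) s <= (size s)./2 ->
  (t%:R / 2 <= median R s)%R.
Proof.
move=> s_gt0 cnt.
have le_t : (t%:R <= (nth 0%N (sort leq s) (size s)./2)%:R :> R)%R.
  rewrite ler_nat; apply: nth_sorted_ge.
  - exact: sort_sorted leq_total _.
  - by rewrite size_sort; lia.
  - by rewrite count_sort.
rewrite /median; case: ifP => _.
  by apply: le_trans le_t; rewrite ler_pdivrMr // ler_peMr // ler1n.
by rewrite ler_pM2r ?invr_gt0 ?ltr0n // ler_wpDl.
Qed.

(** * Distances through paths, and the largest degree *)

Section Dist.
Variable G : network.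

Lemma dist_le_path (A B : node G) (p : seq (node G)) :
  path (@adj G) A p -> last A p = B -> dist A B <= size p.
Proof.
move=> Ap pB; rewrite /dist; case: ex_minnP => n _; apply.
by apply/existsP; exists (in_tuple p); rewrite Ap pB /=.
Qed.

Lemma dist_path (A B : node G) :
  exists2 p, path (@adj G) A p & last A p = B /\ size p = dist A B.
Proof.
rewrite /dist; case: ex_minnP => n /existsP[p /andP[Ap /eqP pB]] _.
by exists p => //; rewrite size_tuple.
Qed.

Lemma dist_le_add (A B C : node G) (p q : seq (node G)) :
  path (@adj G) A p -> last A p = C -> path (@adj G) B q -> last B q = C ->
  dist A B <= size p + size q.
Proof.
move=> Ap pC Bq qC.
(* [rev (belast B q)] is the second path run backwards from [C] to [B]; symmetry of [adj] makes it a
   path. *)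
rewrite -(size_belast B q) -(size_rev (belast B q)) -size_cat.
apply: dist_le_path.
  rewrite cat_path Ap pC -qC rev_path.
  by under eq_path do rewrite adj_sym.
rewrite last_cat pC -qC; case: q {Bq qC} => //= x q.
by rewrite rev_cons last_rcons.
Qed.

Lemma delta1_le (k : nat) :
  (forall A : node G, degree A <= k) -> delta G 1 <= k.
Proof.
move=> deg_le; rewrite /delta /=.
have [lt0|ge0] := ltnP 0 (size (sort geq (degrees G))); last first.
  by rewrite nth_default.
have /= := mem_nth 0 lt0; rewrite mem_sort => /mapP[A _ ->]; exact: deg_le.
Qed.

End Dist.

(** * Connectivity and interval counts on ['I_N] *)

Lemma connect_descent (N : nat) (e : rel 'I_N) : symmetric e ->
  (forall i : 'I_N, 0 < i -> exists2 j : 'I_N, j < i & e i j) ->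
  forall A B, connect e A B.
Proof.
move=> e_sym desc.
(* Strong induction on the index: every node descends to 0, where any two descents meet. *)
have root (A : 'I_N) : exists2 r : 'I_N, val r = 0 & connect e A r.
  have [n] := ubnP (val A); elim: n A => // n IHn A lt_A.
  have [A0|] := posnP A; first by exists A.
  move=> /desc[j lt_j eAj]; have [|r r0 jr] := IHn j.
    by rewrite (leq_trans lt_j).
  by exists r => //; apply: connect_trans jr; apply: connect1.
move=> A B; have [r r0 Ar] := root A; have [r' r'0 Br'] := root B.
have rr' : r = r' by apply: val_inj; rewrite r0 r'0.
by apply: connect_trans Ar _; rewrite sym_connect_sym // rr'.
Qed.

Lemma card_itv_le (N a l : nat) : #|[set B : 'I_N | a <= B < a + l]%SET| <= l.
Proof.
rewrite cardE -(size_map val) -[leqRHS](size_iota a); apply: uniq_leq_size.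
  by rewrite map_inj_uniq ?enum_uniq //; exact: val_inj.
by move=> x /mapP[B]; rewrite mem_enum finset.in_set mem_iota => ? ->.
Qed.

(** * The complete [D]-ary tree *)

Section Heap.
Variables D N : nat.

(* Array layout of the [D]-ary tree: the children of [i] are
   [D * i + 1, ..., D * i + D]. *)
Definition heap_parent (i j : nat) : bool := (0 < j) && (i == j.-1 %/ D).

Definition heap_adj : rel 'I_N := fun i j => heap_parent i j || heap_parent j i.

Lemma ltn_divn_pred (j : nat) : 0 < j -> j.-1 %/ D < j.
Proof. by case: j => [|j] _ //=; rewrite ltnS leq_div. Qed.

Lemma heap_adj_sym : symmetric heap_adj.
Proof. by move=> i j; rewrite /heap_adj orbC. Qed.

Lemma heap_adj_irrefl : irreflexive heap_adj.
Proof.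
move=> i; rewrite /heap_adj orbb; apply/negbTE/negP => /andP[i0 /eqP ii].
by have := ltn_divn_pred i0; rewrite -ii ltnn.
Qed.

Lemma heap_up (i : 'I_N) : 0 < i ->
  exists2 j : 'I_N, val j = i.-1 %/ D & heap_adj i j.
Proof.
move=> i0; have lt_jN : i.-1 %/ D < N.
  exact: ltn_trans (ltn_divn_pred i0) (ltn_ord i).
by exists (Ordinal lt_jN) => //; rewrite /heap_adj /heap_parent i0 eqxx orbT.
Qed.

(** Parents have smaller indices. This covers [D = 0], where division returns 0 and the graph is a
    star around 0. *)
Lemma heap_adj_connected (A B : 'I_N) : connect heap_adj A B.
Proof.
apply: connect_descent A B => [|i i0]; first exact: heap_adj_sym.
have [j jE ij] := heap_up i0.
by exists j; rewrite // jE ltn_divn_pred.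
Qed.

Definition heap : network :=
  Network heap_adj_sym heap_adj_irrefl heap_adj_connected.

Lemma heap_degree (A : node heap) : 0 < D -> degree A <= D.+1.
Proof.
(* The parent, absent at the root, is written as an interval of length 1; the children lie in the
   interval of length [D] from [(A * D).+1]. [card_itv_le] bounds both. *)
move=> D0; have degE : [set B | adj A B]%SET =
    ([set B : 'I_N | A.-1 %/ D <= B < A.-1 %/ D + 1 & 0 < A]
     :|: [set B : 'I_N | heap_parent A B])%SET.
  apply/setP => B; rewrite finset.in_setU !finset.in_set /adj /= /heap_adj orbC.
  congr (_ || _).
  by rewrite /heap_parent addn1 ltnS -eqn_leq andbC eq_sym.
rewrite /degree degE; apply: leq_trans (leq_card_setU _ _) _.
rewrite -[D.+1]add1n; apply: leq_add.
  apply: leq_trans (card_itv_le N (A.-1 %/ D) 1); apply: subset_leq_card.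
  by apply/fintype.subsetP => B; rewrite !finset.in_set => /andP[].
apply: leq_trans (card_itv_le N (A * D).+1 D); apply: subset_leq_card.
apply/fintype.subsetP => B; rewrite !finset.in_set => /andP[B0 /eqP ->].
have := divn_eq B.-1 D; have := ltn_pmod B.-1 D0; lia.
Qed.

(** Each step to the parent divides the index by at least [D]. *)
Lemma heap_climb (n : nat) (A : node heap) : A < D ^ n ->
  exists2 p, path (@adj heap) A p & val (last A p) = 0 /\ size p <= n.
Proof.
elim: n A => [|n IHn] A lt_A; have [A0|A0] := posnP A.
- by exists [::].
- by move: lt_A; rewrite expn0 ltnNge A0.
- by exists [::].
have [j jE Aj] := heap_up A0.
have D0 : 0 < D by rewrite lt0n; apply: contraTneq lt_A => ->; rewrite exp0n.
have [|p jp [p0 sp]] := IHn j.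
  by rewrite jE ltn_divLR // -expnSr (leq_ltn_trans (leq_pred _)).
exists (j :: p); [by apply/andP | by split].
Qed.

Lemma heap_diameter (n : nat) : N <= D ^ n -> diameter heap <= n + n.
Proof.
move=> le_N; apply/bigmax_leqP => A _; apply/bigmax_leqP => B _.
have [p Ap [p0 sp]] := heap_climb (leq_trans (ltn_ord A) le_N).
have [q Bq [q0 sq]] := heap_climb (leq_trans (ltn_ord B) le_N).
apply: leq_trans (leq_add sp sq); apply: dist_le_add Ap erefl Bq _.
by apply: val_inj; rewrite /= q0 p0.
Qed.

End Heap.

(** * Counting ordered pairs of nodes *)

Lemma card_pairs_le (T : finType) (P : rel T) (k : nat) :
  (forall x, #|[set y | P x y]%SET| <= k) ->
  count (fun p => P p.1 p.2) (enum {: T * T}) <= #|T| * k.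
Proof.
move=> P_le; rewrite -sum1_count big_enum_cond /=.
rewrite (eq_bigl (fun p => xpredT p.1 && P p.1 p.2)) //.
rewrite -(pair_big_dep xpredT P (fun _ _ => 1)) /= -sum_nat_const.
by apply: leq_sum => x _; rewrite sum1dep_card.
Qed.

Lemma size_distances_ge (G : network) :
  #|node G| * #|node G| <= #|node G| + size (distances G).
Proof.
rewrite size_map size_filter -card_prod cardE.
(* All ordered pairs split into the diagonal, at most one pair per node, and the pairs listed in
   [distances]. *)
rewrite -(count_predC (fun p : node G * node G => p.1 == p.2)).
rewrite leq_add2r -[leqRHS]muln1; apply: (@card_pairs_le _ eq_op) => x.
by rewrite -(cards1 x); apply: eq_leq; apply: eq_card => y; rewrite !inE eq_sym.
Qed.

(** * The band graph *)

Section Band.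
Variables m N : nat.

(** With half-width [m.+1], consecutive indices are adjacent even for [m = 0]. *)
Definition band_adj : rel 'I_N :=
  fun i j => [&& i != j, i <= j + m.+1 & j <= i + m.+1].

Lemma band_adj_sym : symmetric band_adj.
Proof. by move=> i j; rewrite /band_adj eq_sym [X in _ && X]andbC. Qed.

Lemma band_adj_irrefl : irreflexive band_adj.
Proof. by move=> i; rewrite /band_adj eqxx. Qed.

Lemma band_adj_connected (A B : 'I_N) : connect band_adj A B.
Proof.
apply: connect_descent A B => [|i i0]; first exact: band_adj_sym.
exists (Ordinal (leq_ltn_trans (leq_pred i) (ltn_ord i))) => /=.
  by rewrite ltn_predL.
by rewrite /band_adj -val_eqE /=; lia.
Qed.

Definition band : network :=
  Network band_adj_sym band_adj_irrefl band_adj_connected.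

(** There is room for [m.+1] neighbours on one side of [A]: if not above, then
    [A >= N - m.+1 >= m.+1] leaves them below. *)
Lemma band_degree (A : node band) : m.+1.*2 <= N -> m < degree A.
Proof.
move=> le_N; rewrite -[m.+1]card_ord.
have lt_up (x : 'I_m.+1) : A + m.+1 < N -> A + x.+1 < N.
  by move=> lt_N; apply: leq_ltn_trans lt_N; rewrite leq_add2l.
have lt_dn (x : 'I_m.+1) : A - x.+1 < N.
  exact: leq_ltn_trans (leq_subr _ _) (ltn_ord A).
have [up|dn] := ltnP (A + m.+1) N.
  rewrite -(card_imset (f := fun x => Ordinal (lt_up x up))); last first.
    by move=> x y [] xy; apply: val_inj => /=; lia.
  apply: subset_leq_card; apply/fintype.subsetP => _ /imsetP[x _ ->].
  rewrite finset.in_set /adj /= /band_adj -val_eqE /=.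
  by have := ltn_ord x; lia.
rewrite -(card_imset (f := fun x => Ordinal (lt_dn x))); last first.
  move=> x y [] xy; apply: val_inj => /=.
  by have := ltn_ord x; have := ltn_ord y; lia.
apply: subset_leq_card; apply/fintype.subsetP => _ /imsetP[x _ ->].
rewrite finset.in_set /adj /= /band_adj -val_eqE /=.
by have := ltn_ord x; lia.
Qed.

(** One edge moves the index by at most [m.+1]. *)
Lemma band_path (A : node band) (p : seq (node band)) : path (@adj band) A p ->
  (A <= last A p + size p * m.+1) && (last A p <= A + size p * m.+1).
Proof.
elim: p A => [|B p IHp] A /=; first by rewrite addn0 leqnn.
move=> /andP[/and3P[_ AB BA] /IHp /andP[]].
rewrite mulSn; move: (size p * _) => s; move: (last B p) => C.
by move: A B C AB BA => /= A B C; lia.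
Qed.

Lemma band_dist (A B : node band) :
  (A <= B + dist A B * m.+1) && (B <= A + dist A B * m.+1).
Proof.
by have [p Ap [pB <-]] := dist_path A B; have := band_path Ap; rewrite pB.
Qed.

Lemma count_distances_lt (s t : nat) : t.-1 * m.+1 <= s ->
  count (fun d => d < t) (distances band) <= N * s.*2.+1.
Proof.
move=> le_s; rewrite count_map count_filter -[N in N * _]card_ord.
(* A distance below [t] forces [|i - j| <= s]. When [i < s] the subtraction truncates to 0, and the
   window still contains all such [j]. *)
pose near_pair (i j : 'I_N) := i - s <= j < i - s + s.*2.+1.
apply: leq_trans (@card_pairs_le _ near_pair _ _); last first.
  by move=> i; exact: card_itv_le.
apply: sub_count => -[i j] /= /andP[lt_t _]; rewrite /near_pair.
have /andP[] := band_dist i j.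
have : dist i j * m.+1 <= s.
  by apply: leq_trans le_s; rewrite leq_mul2r /=; lia.
move: (dist i j * _) => d; move: i j {lt_t}; rewrite /= => i j; lia.
Qed.

End Band.

Local Open Scope ring_scope.

(** * Growth rates against [ln N] *)

Section Asymptotics.
Variable R : realType.

(** Logarithms of [b ^ l <= N < b ^ l.+1]. Base 32 compares [k] with [ln N]; base [k] bounds the
    depth of the [k]-ary tree. *)
Lemma trunc_log_ln_bounds (b N : nat) : (1 < b)%N -> (0 < N)%N ->
  (trunc_log b N)%:R * ln (b%:R : R) <= ln (N%:R : R)
    <= (trunc_log b N).+1%:R * ln (b%:R : R).
Proof.
move=> b1 N0; have b0 : (0 : R) < b%:R by rewrite ltr0n ltnW.
have powE k : k%:R * ln (b%:R : R) = ln ((b ^ k)%N%:R : R).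
  by rewrite natrX lnXn // mulr_natl.
rewrite !powE !ler_ln ?posrE ?ltr0n ?expn_gt0 ?(ltnW b1) // !ler_nat.
by rewrite trunc_logP // ltnW // trunc_log_ltn.
Qed.

Lemma near_trunc_log_ge (b k : nat) : (1 < b)%N ->
  \forall N \near \oo, (k <= trunc_log b N)%N.
Proof.
by move=> b1; exists (b ^ k)%N => // N /= le_N; apply: trunc_log_max.
Qed.

Lemma cvgry_not_bounded (f : nat -> R) (K : R) :
  f @ \oo --> +oo -> ~ (\forall N \near \oo, f N <= K).
Proof.
move=> /cvgryPgt/(_ K) gtK leK.
have [N [fN Nf]] := @filter_ex _ \oo _ _ (filterI gtK leK).
by move: fN; rewrite ltNge Nf.
Qed.

Lemma cvgry_over_ln (f : nat -> R) :
  (\forall N \near \oo, ((trunc_log 32 N) ^ 2)%N%:R / 2 <= f N) ->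
  (fun N : nat => f N / ln (N%:R : R)) @ \oo --> +oo.
Proof.
move=> f_ge; apply/cvgryPge => A.
have c0 : 0 < ln (32%:R : R) by rewrite ln_gt0 // ltr1n.
(* With [k = trunc_log 32 N >= 1], [ln N <= k.+1 * ln 32 <= 2 * k * ln 32], so
   [A * ln N <= k ^ 2 / 2] once [k >= 4 * |A| * ln 32]. *)
have [a leAa] : exists a : nat, 4 * `|A| * ln (32%:R : R) <= a%:R.
  by exists (Num.truncn (4 * `|A| * ln (32%:R : R))).+1; exact/ltW/truncnS_gt.
near=> N; have N1 : (1 < N)%N by near: N; exact: nbhs_infty_gt.
have ka : (a <= trunc_log 32 N)%N by near: N; exact: near_trunc_log_ge.
have k1 : (1 <= trunc_log 32 N)%N by near: N; exact: near_trunc_log_ge.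
rewrite ler_pdivlMr ?ln_gt0 ?ltr1n //.
apply: le_trans (_ : _ <= ((trunc_log 32 N) ^ 2)%N%:R / 2) _; last by near: N.
have /andP[_ le_ln] := trunc_log_ln_bounds (isT : 1 < 32)%N (ltnW N1).
apply: le_trans (ler_wpM2r _ (ler_norm A)) _.
  by rewrite ln_ge0 // ler1n ltnW.
apply: le_trans (ler_wpM2l (normr_ge0 A) le_ln) _.
set k := trunc_log 32 N in ka k1 *.
have le_k1 : k.+1%:R <= k%:R * 2 :> R by rewrite -natrM ler_nat muln2; lia.
have le_a : 4 * `|A| * ln (32%:R : R) <= k%:R.
  by apply: le_trans leAa _; rewrite ler_nat.
rewrite natrX mulrCA.
apply: le_trans (ler_wpM2r _ le_k1) _; first by rewrite mulr_ge0 // ltW.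
rewrite expr2 -[_ * _ / 2]mulrA -[_ * 2 * _]mulrA ler_wpM2l ?ler0n //.
by lra.
Unshelve. all: by end_near. Qed.

Lemma heap_delta_bounded :
  \forall N \near \oo, (delta (heap (trunc_log 32 N) N) 1)%:R / ln (N%:R : R)
    <= 2 / ln (32%:R : R).
Proof.
have c0 : 0 < ln (32%:R : R) by rewrite ln_gt0 // ltr1n.
near=> N; have N1 : (1 < N)%N by near: N; exact: nbhs_infty_gt.
have k1 : (1 <= trunc_log 32 N)%N by near: N; exact: near_trunc_log_ge.
have /andP[ge_ln _] := trunc_log_ln_bounds (isT : 1 < 32)%N (ltnW N1).
rewrite ler_pdivrMr ?ln_gt0 ?ltr1n // mulrAC ler_pdivlMr //.
apply: le_trans (ler_wpM2l _ ge_ln); last by rewrite ler0n.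
rewrite mulrA ler_wpM2r ?(ltW c0) // -natrM ler_nat.
apply: leq_trans (delta1_le (fun A => heap_degree A k1)) _; lia.
Unshelve. all: by end_near. Qed.

Lemma heap_diameter_cvg :
  (fun N => (diameter (heap (trunc_log 32 N) N))%:R / ln (N%:R : R)) @ \oo
    --> (0 : R).
Proof.
apply/cvgr0Pnorm_le => e e0.
(* The ratio will be at most [4 / ln k], hence at most [e] once [k >= expR (4 / e)]. *)
have [a leAa] : exists a : nat, expR (4 / e) <= a%:R :> R.
  by exists (Num.truncn (expR (4 / e))).+1; exact/ltW/truncnS_gt.
near=> N; have N1 : (1 < N)%N by near: N; exact: nbhs_infty_gt.
have k2 : (2 <= trunc_log 32 N)%N by near: N; exact: near_trunc_log_ge.
have ka : (a <= trunc_log 32 N)%N by near: N; exact: near_trunc_log_ge.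
have kN : (trunc_log 32 N <= N)%N.
  apply: leq_trans (trunc_logP (isT : 1 < 32)%N (ltnW N1)).
  by rewrite ltnW // ltn_expl.
set k := trunc_log 32 N in k2 ka kN *.
have lnN : 0 < ln (N%:R : R) by rewrite ln_gt0 // ltr1n.
(* With [l = trunc_log k N], the diameter is at most [2 * l.+1], and [l >= 1] turns this into
   [4 * l]. *)
have l1 : (1 <= trunc_log k N)%N by apply: trunc_log_max.
have /andP[ge_ln _] := trunc_log_ln_bounds k2 (ltnW N1).
have ln_k : 4 / e <= ln (k%:R : R).
  rewrite -[4 / e]expRK ler_ln ?posrE ?expR_gt0 ?ltr0n ?(ltnW k2) //.
  by apply: le_trans leAa _; rewrite ler_nat.
have diam : (diameter (heap k N) <= 4 * trunc_log k N)%N.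
  apply: leq_trans (heap_diameter (ltnW (trunc_log_ltn N k2))) _; lia.
rewrite ger0_norm ?divr_ge0 ?ler0n ?(ltW lnN) // ler_pdivrMr //.
apply: le_trans (_ : (4 * trunc_log k N)%N%:R <= _); first by rewrite ler_nat.
apply: le_trans (ler_wpM2l (ltW e0) ge_ln).
rewrite natrM mulrC mulrCA ler_wpM2l ?ler0n // mulrC.
by rewrite -ler_pdivrMr.
Unshelve. all: by end_near. Qed.

(* [32 = 2 * 2 ^ 4] pays for the factor 4 and for [k ^ 4 < (2 ^ k) ^ 4]. *)
Lemma pow32_ge (k : nat) : (2 <= k)%N -> (4 * k ^ 4 + 4 <= 32 ^ k)%N.
Proof.
move=> k2; have -> : (32 ^ k = 2 ^ k * (2 ^ k) ^ 4)%N.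
  by rewrite -expnM -expnD (_ : 32 = 2 ^ 5)%N // -expnM; congr (_ ^ _)%N; lia.
have lt_x : (k ^ 4 < (2 ^ k) ^ 4)%N by rewrite ltn_exp2r // ltn_expl.
have ge_4 : (2 ^ 2 <= 2 ^ k)%N by rewrite leq_exp2l.
by apply: leq_trans (leq_mul ge_4 lt_x); lia.
Qed.

Definition band_seq (N : nat) : network := band (trunc_log 32 N ^ 2) N.

Lemma near_pow_le : \forall N \near \oo, (4 * trunc_log 32 N ^ 4 + 4 <= N)%N.
Proof.
near=> N; apply: leq_trans (_ : 32 ^ trunc_log 32 N <= _)%N; last first.
  by apply: trunc_logP => //; near: N; exact: nbhs_infty_gt.
by apply: pow32_ge; near: N; exact: near_trunc_log_ge.
Unshelve. all: by end_near. Qed.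

Lemma band_median_degrees :
  \forall N \near \oo,
    (trunc_log 32 N ^ 2)%N%:R / 2 <= median R (degrees (band_seq N)).
Proof.
near=> N; have le_N : (4 * trunc_log 32 N ^ 4 + 4 <= N)%N.
  by near: N; exact: near_pow_le.
apply: median_ge; first by rewrite size_map -cardE card_ord; lia.
rewrite (_ : count _ _ = 0)%N //; apply/eqP; rewrite -leqn0 leqNgt -has_count.
apply/hasPn => _ /mapP[A _ ->]; rewrite -leqNgt ltnW // band_degree //.
(* In terms of [x = k ^ 2], [4 * x ^ 2 + 4 <= N] must give [2 * x.+1 <= N]. *)
move: le_N; rewrite (expnM _ 2 2); move: (trunc_log 32 N ^ 2)%N => x; nia.
Unshelve. all: by end_near. Qed.

Lemma band_median_distances :
  \forall N \near \oo,
    (trunc_log 32 N ^ 2)%N%:R / 2 <= median R (distances (band_seq N)).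
Proof.
near=> N; have le_N : (4 * trunc_log 32 N ^ 4 + 4 <= N)%N.
  by near: N; exact: near_pow_le.
have := size_distances_ge (band_seq N); rewrite card_ord => size_ge.
(* Here [m = t = k ^ 2] and [s = k ^ 4], as [(k ^ 2 - 1) * (k ^ 2 + 1) <= k ^ 4]. Twice the count,
   at most [N * (4 * k ^ 4 + 2)], stays below [N * (N - 1)]. *)
have cnt := @count_distances_lt (trunc_log 32 N ^ 2) N (trunc_log 32 N ^ 4)
  (trunc_log 32 N ^ 2).
apply: median_ge; first by nia.
apply: leq_trans (cnt _) _.
  rewrite [leqRHS](_ : _ = (trunc_log 32 N ^ 2) ^ 2)%N; last by rewrite -expnM.
  by case: (_ ^ 2)%N => // x; nia.
by rewrite geq_half_double; nia.
Unshelve. all: by end_near. Qed.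

End Asymptotics.

(** * The two separating sequences *)

Theorem theorem3 (R : realType) :
  (exists Omega : nat -> network,
     network_sequence Omega /\ SWD R Omega /\ ~ DSWL R Omega) /\
  (exists Omega : nat -> network,
     network_sequence Omega /\ DSWMd R Omega /\ ~ SWMd R Omega).
Proof.
split.
  exists (fun N => heap (trunc_log 32 N) N).
  split; first by move=> N _; exact: card_ord.
  split; first by exists 0; split => //; exact: heap_diameter_cvg.
  by move=> /cvgry_not_bounded; apply; exact: heap_delta_bounded.
exists band_seq; split; first by move=> N _; exact: card_ord.
split; first exact/cvgry_over_ln/band_median_degrees.
move=> [C [_ dist_cvg]].
have := cvgry_over_ln (band_median_distances R).
(* A finite limit [C] would keep the ratio eventually below [C + 1], although it tends to
   infinity. *)
move=> /(@cvgry_not_bounded R _ (C + 1)); apply.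
by apply: cvgr_le dist_cvg _ _; rewrite ltrDl.
Qed.
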